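(* Let $(X,\leqslant,\rho)$ be a finite graded poset with minimum and maximum, let $X=A\times B$ be a good decomposition, let $f\in F(X)$ and $g\in F(B)$. If $g\in[\rho_B]$ and $R(f)=g\circ\pi_B$, then $f\in[\rho]$.
   Context: Let $(X,\leqslant,\rho)$ be a finite graded poset with minimum $\hat 0$, maximum $\hat 1$ and rank function $\rho$ (with $\rho(\hat 0)=0$). $F(X)$ is the ring of functions $X\to\mathbb{Z}$. Functions $f,g\in F(X)$ are equidistributed if $\sum_{x\in X}q^{f(x)}=\sum_{x\in X}q^{g(x)}$ in $\mathbb{N}[q,q^{-1}]$. Write $f\sim g$ if $f,g$ are equidistributed, $f(\hat 0)=g(\hat 0)$ and $f(\hat 1)=g(\hat 1)$; $[f]$ denotes the $\sim$-equivalence class of $f$ (similarly for other finite graded posets with minimum and maximum). Decompositions: suppose the underlying set of $X$ is (in bijection with) a cartesian product $A\times B$, with projections $\pi_A,\pi_B$. The sets $A$ and $B$ carry the partial orders induced from $\leqslant$ on $X$, for which all inclusions $a\mapsto(a,b)$ ($b\in B$ fixed) and $b\mapsto(a,b)$ ($a\in A$ fixed) are order preserving (so the order on $X$ is a refinement of the product order; $\pi_A,\pi_B$ need not be order preserving), and $\hat 0=(\hat 0_A,\hat 0_B)$, $\hat 1=(\hat 1_A,\hat 1_B)$, where $\hat 0_A,\hat 1_A$ (resp. $\hat 0_B,\hat 1_B$) are the minimum and maximum of $A$ (resp. $B$). Put $\rho_A(a)=\rho(a,\hat 0_B)$ and $\rho_B(b)=\rho(\hat 0_A,b)$. The decomposition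 is good if $(A,\leqslant,\rho_A)$ and $(B,\leqslant,\rho_B)$ are graded posets (with rank functions $\rho_A,\rho_B$) and $\rho=\rho_A\circ\pi_A+\rho_B\circ\pi_B$. For a good decomposition, $R:F(X)\to F(X)$ is defined by $R(f)=f-\rho_A\circ\pi_A$. *)

(* Defs.v *)
From HB Require Import structures.
From mathcomp Require Import all_boot all_order all_algebra.

Set Implicit Arguments.
Unset Strict Implicit.
Unset Printing Implicit Defensive.

Import Order.TTheory GRing.Theory Num.Theory.
Local Open Scope ring_scope.

Notation "''F' ( X )" := {ffun X -> int}
  (at level 8, X at level 200, format "''F' ( X )") : type_scope.

Section GradedPoset.
Variables (d : Order.disp_t) (X : finTBPOrderType d).

Definition covers (x y : X) : bool :=
  (x < y)%O && ~~ [exists z : X, (x < z)%O && (z < y)%O].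

Definition rank_function (rho : X -> nat) : Prop :=
  [/\ rho \bot%O = 0%N,
      forall x y : X, (x < y)%O -> (rho x < rho y)%N
    & forall x y : X, covers x y -> rho y = (rho x).+1].

Definition rankF (rho : X -> nat) : 'F(X) := [ffun x => (rho x)%:Z].

(* The Laurent polynomial ring Z[q, 1/q] is handled inside its field of
   fractions Z(q), with q := 'X; [q ^ m] is the power with exponent m : int. *)
Definition qvar : {fraction {poly int}} := tofrac 'X.

Definition genfun (f : 'F(X)) : {fraction {poly int}} :=
  \sum_(x : X) qvar ^ (f x).

Definition equidistributed (f g : 'F(X)) : bool := genfun f == genfun g.

Definition sim (f g : 'F(X)) : bool :=
  [&& equidistributed f g, f \bot%O == g \bot%O & f \top%O == g \top%O].

Definition sim_class (f : 'F(X)) : {pred 'F(X)} := [pred g | sim f g].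

End GradedPoset.

Section Decomposition.
Variables (dX dA dB : Order.disp_t).
Variables (X : finTBPOrderType dX) (A : finTBPOrderType dA).
Variable (B : finTBPOrderType dB).

(* In [dec_leA] and [dec_leB], "->" says that the inclusions a |-> (a, b) and
   b |-> (a, b) are order preserving, "<-" that the orders on A and B are
   induced from X. *)
Record decomposition : Type := Decomposition {
  dec_pair : A * B -> X;
  dec_split : X -> A * B;
  dec_splitK : cancel dec_split dec_pair;
  dec_pairK : cancel dec_pair dec_split;
  dec_leA : forall a a' : A,
    (a <= a')%O <-> forall b : B, (dec_pair (a, b) <= dec_pair (a', b))%O;
  dec_leB : forall b b' : B,
    (b <= b')%O <-> forall a : A, (dec_pair (a, b) <= dec_pair (a, b'))%O;
  dec_bot : dec_pair (\bot%O, \bot%O) = \bot%O;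
  dec_top : dec_pair (\top%O, \top%O) = \top%O
}.

Variable D : decomposition.

Definition piA (x : X) : A := (dec_split D x).1.
Definition piB (x : X) : B := (dec_split D x).2.

Variable rho : X -> nat.

Definition rhoA (a : A) : nat := rho (dec_pair D (a, \bot%O)).
Definition rhoB (b : B) : nat := rho (dec_pair D (\bot%O, b)).

Definition good_decomposition : Prop :=
  [/\ rank_function rhoA, rank_function rhoB
    & forall x : X, rho x = (rhoA (piA x) + rhoB (piB x))%N].

Definition Rmap (f : 'F(X)) : 'F(X) := f - [ffun x => rankF rhoA (piA x)].

End Decomposition.

(* Main.v *)
Require Import Defs.
From mathcomp Require Import all_boot all_order all_algebra.

(** Through the bijection between [X] and [A * B], the hypothesis on [f] reads
    f(a, b) = rhoA(a) + g(b), while goodness of the decomposition reads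
    rho(a, b) = rhoA(a) + rhoB(b).  A function on [X] that is such a sum of a
    function of [a] and a function of [b] has a generating function that
    factors as a product ([genfun_dec_sum]).  Hence the generating functions
    of [f] and [rho] are those of [g] and [rhoB], multiplied by the same factor
    coming from [rhoA], and they agree because [g] and [rhoB] are
    equidistributed.  The conditions at the minimum and the maximum transfer
    in the same way ([sim_dec_sum]), since these elements of [X] are the pairs
    of minima and of maxima. *)

Section DecomposedSums.
Local Open Scope ring_scope.

Lemma qvar_neq0 : qvar != 0.
Proof. by rewrite /qvar tofrac_eq0 polyX_eq0. Qed.

Context {dX dA dB : Order.disp_t}.
Context {X : finTBPOrderType dX} {A : finTBPOrderType dA}.
Context {B : finTBPOrderType dB}.
Variable D : decomposition X A B.

Definition dec_sum (u : 'F(A)) (v : 'F(B)) : 'F(X) :=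
  [ffun x => u (piA D x) + v (piB D x)].

Lemma dec_sum_pair u v a b : dec_sum u v (dec_pair D (a, b)) = u a + v b.
Proof. by rewrite ffunE /piA /piB dec_pairK. Qed.

(** Exponents add, so after summing over pairs instead of over [X] the double
    sum separates. *)
Lemma genfun_dec_sum u v : genfun (dec_sum u v) = genfun u * genfun v.
Proof.
rewrite /genfun (reindex (dec_pair D)) /=; last first.
  exact: onW_bij (Bijective (dec_pairK D) (dec_splitK D)).
rewrite big_distrlr pair_bigA /=; apply: eq_bigr => -[a b] _.
by rewrite dec_sum_pair (expfzDr _ _ qvar_neq0).
Qed.

Lemma sim_dec_sum u v w : sim v w -> sim (dec_sum u v) (dec_sum u w).
Proof.
case/and3P=> /eqP vw /eqP bot_vw /eqP top_vw; apply/and3P; split.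
- by rewrite /equidistributed !genfun_dec_sum vw.
- by rewrite -(dec_bot D) !dec_sum_pair bot_vw.
- by rewrite -(dec_top D) !dec_sum_pair top_vw.
Qed.

Lemma rankF_dec_sum (rho : X -> nat) :
  good_decomposition D rho ->
  rankF rho = dec_sum (rankF (rhoA D rho)) (rankF (rhoB D rho)).
Proof. by case=> _ _ rhoE; apply/ffunP=> x; rewrite !ffunE rhoE PoszD. Qed.

Lemma Rmap_dec_sum (rho : X -> nat) (f : 'F(X)) (g : 'F(B)) :
  Rmap D rho f = [ffun x => g (piB D x)] ->
  f = dec_sum (rankF (rhoA D rho)) g.
Proof.
move/ffunP=> Rf; apply/ffunP=> x; have := Rf x.
by rewrite !ffunE => <-; rewrite GRing.addrC GRing.subrK.
Qed.

End DecomposedSums.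

Theorem proposition3p6 (dX dA dB : Order.disp_t)
    (X : finTBPOrderType dX) (A : finTBPOrderType dA) (B : finTBPOrderType dB)
    (rho : X -> nat) (D : decomposition X A B)
    (f : 'F(X)) (g : 'F(B)) :
  rank_function rho ->
  good_decomposition D rho ->
  g \in sim_class (rankF (rhoB D rho)) ->
  Rmap D rho f = [ffun x => g (piB D x)] ->
  f \in sim_class (rankF rho).
Proof.
move=> _ good; rewrite !inE => sim_g /Rmap_dec_sum ->.
by rewrite (rankF_dec_sum _ _ good); apply: sim_dec_sum.
Qed.
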